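(* For every integer $r\ge 2$, let $\{c_k^{(r)}\}_{k=0,1,\dots}$ be the sequence of numbers, independent of the parameter $n$, defined by $$\sum_{k=0}^n\binom nk^r\binom{n+k}k^r=\sum_{k=0}^n\binom nk\binom{n+k}k\,c_k^{(r)},\qquad n=0,1,2,\dots.$$ Then all the numbers $c_k^{(r)}$ are integers. In particular, one has the explicit expressions $$c_n^{(4)}=\sum_j\binom{2j}j^3\binom nj\sum_k\binom{k+j}{k-j}\binom j{n-k}\binom kj\binom{2j}{k-j},$$ $$c_n^{(5)}=\sum_j\binom{2j}j^4\binom nj^2\sum_k\binom{k+j}{k-j}^2\binom{2j}{n-k}\binom{2j}{k-j},$$ and in general, for $s=1,2,\dots$, $$c_n^{(2s)}=\sum_j\binom{2j}j^{2s-1}\binom nj\sum_{k_1}\binom j{n-k_1}\binom{k_1}j\binom{k_1+j}{k_1-j}\sum_{k_2}\binom{2j}{k_1-k_2}\binom{k_2+j}{k_2-j}^2\cdots\sum_{k_{s-1}}\binom{2j}{k_{s-2}-k_{s-1}}\binom{k_{s-1}+j}{k_{s-1}-j}^2\binom{2j}{k_{s-1}-j},$$ $$c_n^{(2s+1)}=\sum_j\binom{2j}j^{2s}\binom nj^2\sum_{k_1}\binom{2j}{n-k_1}\binom{k_1+j}{k_1-j}^2\sum_{k_2}\binom{2j}{k_1-k_2}\binom{k_2+j}{k_2-j}^2\cdots\sum_{k_{s-1}}\binom{2j}{k_{s-2}-k_{s-1}}\binom{k_{s-1}+j}{k_{s-1}-j}^2\binom{2j}{k_{s-1}-j},$$ where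 $n=0,1,2,\dots$.
   Context: Sums written without explicit limits run over all non-negative integer values of the summation index; they terminate, with the usual convention that $\binom ab=0$ if $b<0$ or $b>a$ (for integers $a\ge 0$ and $b$). In the two general formulas the dots indicate nested summations over $k_1,k_2,\dots,k_{s-1}$, with each index $k_i$ for $i\ge 2$ contributing the factor $\binom{2j}{k_{i-1}-k_i}\binom{k_i+j}{k_i-j}^2$, and with the single last factor $\binom{2j}{k_{s-1}-j}$; thus $s=2$ gives the displayed expressions for $c_n^{(4)}$ and $c_n^{(5)}$. The range $s=1,2,\dots$ is that of the original statement, which gives no separate convention for reading the displays at $s=1$, where there are no indices $k_i$. *)

(* Defs.v *)
From HB Require Import structures.
From mathcomp Require Import all_boot all_order all_algebra.
From mathcomp Require Import classical_sets fsbigop.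

Set Implicit Arguments.
Unset Strict Implicit.
Unset Printing Implicit Defensive.

Import Order.TTheory GRing.Theory Num.Theory.

Local Open Scope ring_scope.

(* The natural-number counterpart of the finitely supported sum of fsbigop.
   With A = [set: nat] it is the sum over all non-negative integers of a
   function that vanishes from some point on; by convention it is 0 when the
   support is infinite, which never happens below because of the vanishing
   binomial factors. *)
Notation "\sum_ ( i '\in' A ) F" :=
  (\big[addn/0%N]_(i \in A) F%N) : nat_scope.

(* Binomial coefficient with an integer lower entry, 0 when that entry is
   negative.  It is used wherever the lower entry is a difference, which
   truncated subtraction on nat would turn into a coefficient equal to 1. *)
Definition binz (a : nat) (b : int) : nat :=
  if b is Posz m then 'C(a, m) else 0%N.

Arguments binz a%_N b%_R.

Definition schmidt_seq (F : numFieldType) (r : nat) (c : nat -> F) : Prop :=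
  forall n : nat,
    (\sum_(k < n.+1) 'C(n, k) ^ r * 'C(n + k, k) ^ r)%N%:R
    = \sum_(k < n.+1) ('C(n, k) * 'C(n + k, k))%N%:R * c k.

(* The defining identity is a triangular linear system, so that the sequence
   exists and is unique. *)
Lemma schmidt_seq_exists (F : numFieldType) (r : nat) :
  exists c : nat -> F, schmidt_seq r c.
Proof.
pose a n : F := (\sum_(k < n.+1) 'C(n, k) ^ r * 'C(n + k, k) ^ r)%N%:R.
pose b n k : F := ('C(n, k) * 'C(n + k, k))%N%:R.
pose step n (t : seq F) := (a n - \sum_(k < n) b n k * t`_k) / b n n.
pose t := fix t n := if n is m.+1 then rcons (t m) (step m (t m)) else [::].
have sz n : size (t n) = n by elim: n => //= n IH; rewrite size_rcons IH.
have tE n k : (k < n)%N -> (t n)`_k = step k (t k).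
  elim: n => // n IH; rewrite ltnS leq_eqVlt /= nth_rcons sz.
  by case/predU1P=> [->|lt_kn]; rewrite ?ltnn ?eqxx // lt_kn IH.
exists (fun n => step n (t n)) => n; rewrite -/(a n) big_ord_recr /=.
have bn0 : b n n != 0.
  by rewrite pnatr_eq0 muln_eq0 negb_or -!lt0n !bin_gt0 leqnn leq_addl.
have -> : step n (t n) = (a n - \sum_(k < n) b n k * step k (t k)) / b n n.
  by congr ((_ - _) / _); apply: eq_bigr => k _; rewrite tE.
by rewrite -/(b n n) [b n n * _]mulrC divfK // addrC subrK.
Qed.

Lemma schmidt_seq_unique (F : numFieldType) (r : nat) (c d : nat -> F) :
  schmidt_seq r c -> schmidt_seq r d -> c =1 d.
Proof.
move=> hc hd n; elim/ltn_ind: n => n IH.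
have := hc n; rewrite (hd n) !big_ord_recr /=.
under eq_bigr => k _ do rewrite -IH //.
move/addrI/mulfI => -> //.
by rewrite pnatr_eq0 muln_eq0 negb_or -!lt0n !bin_gt0 leqnn leq_addl.
Qed.

Local Open Scope nat_scope.

(* The m innermost nested summations, entered from the summation index k,
   together with the single last factor. *)
Fixpoint schmidt_nested (j m k : nat) : nat :=
  if m is m'.+1 then
    \sum_(l \in [set: nat])
      binz (2 * j) (k%:Z - l%:Z) * binz (l + j) (l%:Z - j%:Z) ^ 2
      * schmidt_nested j m' l
  else binz (2 * j) (k%:Z - j%:Z).

(* In both formulas consecutive entries of the chain n, k_1, ..., k_(s-1), j
   are linked by one binomial coefficient in their difference, with upper entry
   2j except for the first link of the even formula, whose upper entry is j.
   For s = 1 there is no inner index and the only link goes from n to j. *)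
Definition schmidt_even (s n : nat) : nat :=
  \sum_(j \in [set: nat])
    'C(2 * j, j) ^ (2 * s - 1) * 'C(n, j)
    * (if s is s'.+2 then
         \sum_(k \in [set: nat])
           binz j (n%:Z - k%:Z) * 'C(k, j) * binz (k + j) (k%:Z - j%:Z)
           * schmidt_nested j s' k
       else binz j (n%:Z - j%:Z)).

Definition schmidt_odd (s n : nat) : nat :=
  \sum_(j \in [set: nat])
    'C(2 * j, j) ^ (2 * s) * 'C(n, j) ^ 2 * schmidt_nested j (s - 1) n.

(* Main.v *)
Require Import Defs.
From mathcomp Require Import all_boot all_order all_algebra.
From mathcomp Require Import classical_sets fsbigop.
From mathcomp Require Import ring zify.
Import GRing.Theory Num.Theory.
Local Open Scope ring_scope.

(** Fix [N] and put [b_k = 'C(N, k) * 'C(N + k, k)], [x = N (N + 1)].  As a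
    function of [N], [b_k] is a polynomial of degree [k] in [x], because
    [(k + 1)^2 b_(k+1) = (x - k (k + 1)) b_k] ([legendre_coefS]); it is also the
    coefficient of [t^k] in the Legendre polynomial [P_N(1 + 2 t)].  Hence every
    power [b_j^r] is a combination of the [b_n] with coefficients independent
    of [N], and summing over [j] expands [sum_j b_j^r]; by uniqueness,
    [c_n^(r)] is the sum over [j] of the coefficient of [b_n] in [b_j^r].
    The stated formulas hold term by term in [j]: their [j]-th summand is that
    coefficient ([legendre_coef_odd_power], [legendre_coef_even_power]).

    Two linearization identities give these coefficients:
    - [b_j b_k = 'C(k+j, j) sum_m 'C(m, j) 'C(j, m-k) b_m]
      ([legendre_coef_mul]);
    - [b_j^2 b_k = 'C(k+j, j)^2 sum_m 'C(m, j)^2 'C(2j, m-k) b_m]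
      ([legendre_coef_sqr_mul]).

    The second one, at [k = j], gives [b_j^3]; each further multiplication by
    [b_j^2] creates one more nested summation, which yields all odd powers.
    The first one then passes from an odd power to the next even one, and
    gives [b_j^2] directly.  The factors match those of the nested sums because
    ['C(l+j, j) 'C(l, j) = 'C(2j, j) 'C(l+j, l-j)].

    Both linearizations go by induction on [j]: replacing [b_j] by [b_(j+1)]
    amounts to multiplying by [x - j (j + 1)], whose effect on the
    coefficients is a two-term recurrence.  Pascal's rule and the absorption
    identity merge its two terms into one product, so the closed form
    persists ([multiplier_step]). *)

(** * Binomial coefficients and finitely supported sums *)

Lemma natr_binS_lower n j :
  j.+1%:R * 'C(n, j.+1)%:R = (n%:R - j%:R) * 'C(n, j)%:R :> int.
Proof.
rewrite -natrM mul_bin_left natrM; case: (leqP j n) => [lejn | ltnj].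
  by rewrite natrB.
by rewrite bin_small // !mulr0.
Qed.

Lemma natr_binS_upper n j :
  n.+1%:R * 'C(n, j)%:R = (n.+1%:R - j%:R) * 'C(n.+1, j)%:R :> int.
Proof. by rewrite -natr_binS_lower -!natrM mul_bin_diag. Qed.

Lemma natr_binSS n j :
  j.+1%:R * 'C((n + j).+1, j.+1)%:R = (n + j).+1%:R * 'C(n + j, j)%:R :> int.
Proof. by rewrite -!natrM -mul_bin_diag. Qed.

Lemma natr_bin0 j : j%:R * 'C(0, j)%:R = 0 :> int.
Proof. by case: j => [|j]; rewrite ?mul0r ?mulr0. Qed.

Lemma binz_pascal p (d : int) : binz p.+1 d = (binz p d + binz p (d - 1))%N.
Proof.
case: d => [[|d]|d] //; first by rewrite /= !bin0.
by have -> : d.+1%:Z - 1 = d by lia.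
Qed.

Lemma binz_absorb p (d : int) :
  (p.+1%:R - d) * (binz p (d - 1))%:R = d * (binz p d)%:R :> int.
Proof.
case: d => [[|d]|d]; rewrite ?mulr0 ?mul0r //.
have -> : d.+1%:Z - 1 = d by lia.
by rewrite /= -natz natr_binS_lower !mulrS; ring.
Qed.

Lemma binz_small a k l : (k < l)%N -> binz a (k%:Z - l%:Z) = 0%N.
Proof.
move=> ltkl; have -> : k%:Z - l%:Z = Negz (l - k.+1) by lia.
by [].
Qed.

Lemma binz_sub a k l : (l <= k)%N -> binz a (k%:Z - l%:Z) = 'C(a, k - l).
Proof. by move=> lelk; rewrite subzn. Qed.

(** Both sides are [(l + j)! / (j!^2 (l - j)!)].  This turns the factors
    produced by the linearizations into those of the nested sums. *)
Lemma bin_mul_diag l j :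
  ('C(l + j, j) * 'C(l, j) = 'C(2 * j, j) * binz (l + j) (l%:Z - j%:Z))%N.
Proof.
case: (leqP j l) => [lejl | ltlj]; last by rewrite (bin_small ltlj) binz_small // !muln0.
rewrite binz_sub //.
have e1 := bin_fact (leq_addl l j); have e2 := bin_fact lejl.
have e3 := bin_fact (leq_addr j j).
have /bin_fact e4 : (l - j <= l + j)%N by lia.
rewrite addnK in e1; rewrite addnK addnn -mul2n in e3.
have e5 : (l + j - (l - j) = 2 * j)%N by lia.
rewrite e5 in e4.
apply/eqP; rewrite -(eqn_pmul2r (fact_gt0 j)) -(eqn_pmul2r (fact_gt0 j)).
rewrite -(eqn_pmul2r (fact_gt0 (l - j))); apply/eqP.
nia.
Qed.

(** Every sum over all of [nat] below has its support in an initial segment;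
    a common bound for all of them makes the summations exchangeable. *)
Lemma nat_sum_trunc n (f : nat -> nat) :
  (forall i, n <= i -> f i = 0)%N ->
  (\sum_(i \in [set: nat]) f i = \sum_(i < n) f i)%N.
Proof.
move=> f0; rewrite (fsbig_ord addn n f); apply/esym/fsbig_widen => // i [_ /=].
by move/negP; rewrite -leqNgt => /f0.
Qed.

(** * Linearization of products of Legendre coefficients *)

(** The coefficient of [t^k] in the Legendre polynomial [P_N(1 + 2 t)]. *)
Definition legendre_coef (N k : nat) : nat := ('C(N, k) * 'C(N + k, k))%N.

Lemma legendre_coef_small N k : (N < k)%N -> legendre_coef N k = 0%N.
Proof. by move=> ltNk; rewrite /legendre_coef bin_small. Qed.

Lemma legendre_coefS N k :
  k.+1%:R ^+ 2 * (legendre_coef N k.+1)%:R =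
  (N%:R - k%:R) * (N%:R + k.+1%:R) * (legendre_coef N k)%:R :> int.
Proof.
rewrite /legendre_coef addnS !natrM expr2 mulrACA natr_binSS natr_binS_lower.
by rewrite mulrACA -addnS natrD.
Qed.

Lemma legendre_coef0 N : legendre_coef N 0 = 1%N.
Proof. by rewrite /legendre_coef !bin0. Qed.

(** With [x = N (N + 1)] and [b_m] the Legendre coefficients of [N], the outer
    factor is [x - j (j + 1) = (x - m (m + 1)) + (m - j) (m + j + 1)], and
    [x - m (m + 1)] sends [b_m] to [(m + 1)^2 b_(m+1)].  The new coefficient of
    [b_m] thus combines the old ones at [m - 1] and [m].  The assumption on the
    ratio of [g] makes it [(m - j) g_m] times a combination of ['C(q+j, d-1)]
    and ['C(q+j, d)], with [d = m - k], which absorption turns into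
    [(k + j + 1) 'C(q+j+1, d)].  At [m = 0] only the second contribution
    exists; it has to vanish, whence the condition on [g 0].

    The case [q = 0] serves to multiply by [b_j]; the cases [q = j] and
    [q = j + 1] are the two halves of a multiplication by [b_j^2]. *)
Lemma multiplier_step (g : nat -> int) (q j k N : nat) :
    j%:R * g 0%N = 0 ->
    (forall m, m.+1%:R ^+ 2 * g m = (m.+1%:R - j%:R) * (m.+1%:R - q%:R) * g m.+1) ->
  (N%:R - j%:R) * (N%:R + j.+1%:R) *
    (\sum_(m < N.+1) g m * (binz (q + j) (m%:Z - k%:Z))%:R * (legendre_coef N m)%:R)
  = (k + j).+1%:R *
    (\sum_(m < N.+1) (m%:R - j%:R) * g m * (binz (q + j).+1 (m%:Z - k%:Z))%:R
                     * (legendre_coef N m)%:R).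
Proof.
move=> g0 gS; rewrite !mulr_sumr.
pose a m : int := g m * (binz (q + j) (m%:Z - k%:Z))%:R.
(* x - j (j + 1) = (x - m (m + 1)) + (m - j) (m + j + 1), applied to b_m *)
have split_term (m : nat) :
    (N%:R - j%:R) * (N%:R + j.+1%:R) * (a m * (legendre_coef N m)%:R) =
    a m * (m.+1%:R ^+ 2 * (legendre_coef N m.+1)%:R)
    + (m%:R - j%:R) * (m%:R + j.+1%:R) * a m * (legendre_coef N m)%:R :> int.
  by rewrite legendre_coefS !mulrS; ring.
under eq_bigr => m _ do rewrite split_term.
rewrite big_split /= big_ord_recr /= legendre_coef_small // !mulr0 addr0.
rewrite big_ord_recl [RHS]big_ord_recl /= addrCA -big_split /=; congr (_ + _).
  have jg0 : (0 - j%:R) * g 0%N = 0 by rewrite sub0r mulNr g0 oppr0.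
  rewrite /a mulrACA -!mulrA mulrCA; apply/eqP; move/eqP: jg0.
  by rewrite mulf_eq0 => /orP [] /eqP ->; rewrite !(mul0r, mulr0).
apply: eq_bigr => m _; rewrite /bump /= add1n /a binz_pascal.
have := binz_absorb (q + j) (m.+1%:Z - k%:Z).
have -> : m.+1%:Z - k%:Z - 1 = m%:Z - k%:Z by lia.
set u := (binz _ (m%:Z - k%:Z))%:R; set v := (binz _ (m.+1%:Z - k%:Z))%:R => uv.
transitivity ((m.+1%:R ^+ 2 * g m * u
    + (m.+1%:R - j%:R) * (m.+1%:R + j.+1%:R) * g m.+1 * v) * (legendre_coef N m.+1)%:R).
  by ring.
rewrite gS.
(* modulo the absorption relation uv, (m + 1 - q) u + (m + j + 2) v equals
   (k + j + 1) (u + v) *)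
have -> : (m.+1%:R - j%:R) * (m.+1%:R - q%:R) * g m.+1 * u
   + (m.+1%:R - j%:R) * (m.+1%:R + j.+1%:R) * g m.+1 * v
 = (m.+1%:R - j%:R) * g m.+1 * ((k + j).+1%:R * (v + u)
     - ((q + j).+1%:R - (m.+1%:Z - k%:Z)) * u + (m.+1%:Z - k%:Z) * v).
  by rewrite -!natz !mulrS !natrD; ring.
by rewrite uv natrD -/u -/v; ring.
Qed.

Lemma sum_binz0 N k :
  (\sum_(m < N.+1) binz 0 (m%:Z - k%:Z) * legendre_coef N m = legendre_coef N k)%N.
Proof.
have binz0 (m : nat) : binz 0 (m%:Z - k%:Z) = (m == k).
  have -> : (m == k) = (m%:Z - k%:Z == 0) by rewrite subr_eq0.
  by case: (m%:Z - k%:Z) => [[|d]|d].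
under eq_bigr => m _ do rewrite binz0.
case: (leqP k N) => [lekN|ltNk].
  rewrite (bigD1 (inord k)) //= inordK // eqxx mul1n big1 ?addn0 // => m.
  by rewrite -val_eqE /= inordK // => /negPf ->.
rewrite legendre_coef_small // big1 // => m _.
by rewrite ltn_eqF // (leq_trans (ltn_ord m)).
Qed.

(** The step from [j] to [j + 1] is one multiplication by
    [N (N + 1) - j (j + 1) = (N - j) (N + j + 1)], followed by a division by
    [(j + 1)^2]. *)
Lemma legendre_coef_mul N j k :
  (legendre_coef N j * legendre_coef N k =
   'C(k + j, j) *
   \sum_(m < N.+1) 'C(m, j) * binz j (m%:Z - k%:Z) * legendre_coef N m)%N.
Proof.
elim: j => [|j IH].
  under eq_bigr => m _ do rewrite bin0 mul1n.
  by rewrite sum_binz0 legendre_coef0 bin0 !mul1n.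
have j0 : j.+1%:R ^+ 2 != 0 :> int by rewrite expf_neq0 // pnatr_eq0.
apply/eqP; rewrite -(eqr_nat int); apply/eqP/(mulfI j0).
rewrite natrM [X in _ = _ * X]natrM natr_sum.
have {}IH : (legendre_coef N j)%:R * (legendre_coef N k)%:R = 'C(k + j, j)%:R *
    \sum_(m < N.+1) 'C(m, j)%:R * (binz j (m%:Z - k%:Z))%:R * (legendre_coef N m)%:R :> int.
  rewrite -natrM IH natrM natr_sum; congr (_ * _).
  by apply: eq_bigr => m _; rewrite 2!natrM.
rewrite mulrA legendre_coefS -[LHS]mulrA IH mulrCA.
have /= := multiplier_step (fun m => 'C(m, j)%:R) 0 j k N (natr_bin0 j).
rewrite add0n => ->; last first.
  by move=> m; rewrite expr2 -mulrA natr_binS_upper; ring.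
transitivity (j.+1%:R * 'C((k + j).+1, j.+1)%:R *
   (\sum_(m < N.+1) j.+1%:R * 'C(m, j.+1)%:R
      * (binz j.+1 (m%:Z - k%:Z))%:R * (legendre_coef N m)%:R) : int).
  rewrite natr_binSS mulrCA mulrA; congr (_ * _).
  by apply: eq_bigr => m _; rewrite natr_binS_lower.
rewrite addnS !mulr_sumr; apply: eq_bigr => m _; rewrite 2!natrM; ring.
Qed.

(** Applying [legendre_coef_mul] twice would leave a sum of Saalschuetz type in
    each coefficient.  In the induction on [j], the two successive
    multiplications by [(N - j) (N + j + 1)] keep a closed form at every stage,
    with ['C(2j, m-k)] becoming ['C(2j+1, m-k)] and then ['C(2j+2, m-k)]. *)
Lemma legendre_coef_sqr_mul N j k :
  (legendre_coef N j ^ 2 * legendre_coef N k =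
   'C(k + j, j) ^ 2 *
   \sum_(m < N.+1) 'C(m, j) ^ 2 * binz (2 * j) (m%:Z - k%:Z) * legendre_coef N m)%N.
Proof.
elim: j => [|j IH].
  under eq_bigr => m _ do rewrite bin0 exp1n mul1n.
  by rewrite sum_binz0 legendre_coef0 bin0 !exp1n !mul1n.
have j0 : j.+1%:R ^+ 4 != 0 :> int by rewrite expf_neq0 // pnatr_eq0.
apply/eqP; rewrite -(eqr_nat int); apply/eqP/(mulfI j0).
rewrite natrM [X in _ = _ * X]natrM !natrX natr_sum.
have {}IH : (legendre_coef N j)%:R ^+ 2 * (legendre_coef N k)%:R = 'C(k + j, j)%:R ^+ 2 *
    \sum_(m < N.+1)
      'C(m, j)%:R ^+ 2 * (binz (j + j) (m%:Z - k%:Z))%:R * (legendre_coef N m)%:R :> int.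
  rewrite -natrX -natrM IH natrM natrX natr_sum addnn -mul2n; congr (_ * _).
  by apply: eq_bigr => m _; rewrite 2!natrM natrX.
set x : int := (N%:R - j%:R) * (N%:R + j.+1%:R).
have -> : j.+1%:R ^+ 4 * ((legendre_coef N j.+1)%:R ^+ 2 * (legendre_coef N k)%:R)
   = x * (x * ((legendre_coef N j)%:R ^+ 2 * (legendre_coef N k)%:R)) :> int.
  transitivity ((j.+1%:R ^+ 2 * (legendre_coef N j.+1)%:R) ^+ 2 * (legendre_coef N k)%:R : int).
    by ring.
  by rewrite legendre_coefS /x; ring.
rewrite IH 2!(mulrCA x ('C(k + j, j)%:R ^+ 2)).
have /= := multiplier_step (fun m => 'C(m, j)%:R ^+ 2) j j k N; rewrite -/x => ->; first last.
- by move=> m; rewrite -exprMn natr_binS_upper; ring.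
- by rewrite expr2 mulrA natr_bin0 mul0r.
rewrite (mulrCA x (k + j).+1%:R) -addSn.
have /= := multiplier_step (fun m => (m%:R - j%:R) * 'C(m, j)%:R ^+ 2) j.+1 j k N.
rewrite -/x => ->; first last.
- move=> m; transitivity ((m%:R - j%:R) * (m.+1%:R * 'C(m, j)%:R) ^+ 2 : int); first by ring.
  by rewrite natr_binS_upper !mulrS; ring.
- by rewrite sub0r mulNr expr2 (mulrA j%:R 'C(0, j)%:R) natr_bin0 mul0r oppr0 mulr0.
transitivity ((j.+1%:R * 'C((k + j).+1, j.+1)%:R) ^+ 2 *
   (\sum_(m < N.+1) (j.+1%:R * 'C(m, j.+1)%:R) ^+ 2
      * (binz (2 * j.+1) (m%:Z - k%:Z))%:R * (legendre_coef N m)%:R) : int).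
  rewrite natr_binSS !mulrA; congr (_ * _); first by ring.
  apply: eq_bigr => m _; rewrite natr_binS_lower mul2n -addnn !addSn addnS; ring.
rewrite addnS !mulr_sumr; apply: eq_bigr => m _; rewrite 2!natrM natrX; ring.
Qed.

(** * Powers of a Legendre coefficient *)

Lemma schmidt_nestedS j m k N : (k <= N)%N ->
  schmidt_nested j m.+1 k =
  (\sum_(l < N.+1) binz (2 * j) (k%:Z - l%:Z) * binz (l + j) (l%:Z - j%:Z) ^ 2
                   * schmidt_nested j m l)%N.
Proof.
move=> lekN; apply: nat_sum_trunc => l ltNl.
by rewrite binz_small // (leq_ltn_trans lekN).
Qed.

(** The [j]-th summand of [schmidt_odd s n]; it turns out to be the coefficient
    of [legendre_coef N n] in [legendre_coef N j ^ (2 * s + 1)]. *)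
Definition odd_term (s n j : nat) : nat :=
  ('C(2 * j, j) ^ (2 * s) * 'C(n, j) ^ 2 * schmidt_nested j (s - 1) n)%N.

(** The [j]-th summand of [schmidt_even s n], playing the same role for the
    exponent [2 * s]. *)
Definition even_term (s n j : nat) : nat :=
  ('C(2 * j, j) ^ (2 * s - 1) * 'C(n, j)
    * (if s is s'.+2 then
         \sum_(k \in [set: nat])
           binz j (n%:Z - k%:Z) * 'C(k, j) * binz (k + j) (k%:Z - j%:Z)
           * schmidt_nested j s' k
       else binz j (n%:Z - j%:Z)))%N.

Lemma mul_expansion N (a : nat -> nat) (d : nat -> nat -> nat) x :
    (forall l, (x * legendre_coef N l = \sum_(n < N.+1) d l n * legendre_coef N n)%N) ->
  (x * (\sum_(l < N.+1) a l * legendre_coef N l) =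
   \sum_(n < N.+1) (\sum_(l < N.+1) a l * d l n) * legendre_coef N n)%N.
Proof.
move=> xE; rewrite big_distrr /=.
under eq_bigr => l _ do rewrite mulnCA xE big_distrr /=.
rewrite exchange_big /=; apply: eq_bigr => n _; rewrite big_distrl /=.
by apply: eq_bigr => l _; rewrite mulnA.
Qed.

(** Each multiplication by [legendre_coef N j ^ 2] through
    [legendre_coef_sqr_mul] adds the outermost summation of the nested sum: the
    old outer factor ['C(l, j) ^ 2] combines with ['C(l + j, j) ^ 2] by
    [bin_mul_diag], and a new ['C(n, j) ^ 2] appears. *)
Lemma legendre_coef_odd_power N j s : (0 < s)%N ->
  (legendre_coef N j ^ (2 * s + 1) =
   \sum_(n < N.+1) odd_term s n j * legendre_coef N n)%N.
Proof.
case: s => // s _; rewrite /odd_term subn1 /=.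
elim: s => [|s IH].
  rewrite addn1 expnSr muln1 legendre_coef_sqr_mul big_distrr /=.
  by apply: eq_bigr => n _; rewrite addnn -mul2n !mulnA.
have -> : (2 * s.+2 + 1 = 2 + (2 * s.+1 + 1))%N by lia.
rewrite expnD IH.
rewrite (mul_expansion N
  (fun l => 'C(2 * j, j) ^ (2 * s.+1) * 'C(l, j) ^ 2 * schmidt_nested j s l)%N
  (fun l n => 'C(l + j, j) ^ 2 *
   ('C(n, j) ^ 2 * binz (2 * j) (n%:Z - l%:Z)))%N); last first.
  move=> l; rewrite legendre_coef_sqr_mul big_distrr /=.
  by apply: eq_bigr => n _; rewrite !mulnA.
apply: eq_bigr => n _; congr (_ * _)%N.
rewrite (@schmidt_nestedS _ _ _ N) -1?ltnS // big_distrr /=.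
apply: eq_bigr => l _.
have -> : (2 * s.+2 = 2 * s.+1 + 2)%N by lia.
rewrite expnD.
transitivity ('C(2 * j, j) ^ (2 * s.+1) * ('C(l + j, j) * 'C(l, j)) ^ 2 * schmidt_nested j s l *
   ('C(n, j) ^ 2 * binz (2 * j) (n%:Z - l%:Z)))%N; first by rewrite expnMn; lia.
by rewrite bin_mul_diag expnMn; lia.
Qed.

(** One multiplication by [legendre_coef N j] on top of an odd power produces
    the exceptional first link of the even formula: a single factor
    ['C(l, j)] is absorbed by [bin_mul_diag] and the other one remains. *)
Lemma legendre_coef_even_power N j s : (0 < s)%N ->
  (legendre_coef N j ^ (2 * s) =
   \sum_(n < N.+1) even_term s n j * legendre_coef N n)%N.
Proof.
case: s => [//|[|s]] _.
  rewrite expnSr expn1 legendre_coef_mul big_distrr /=.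
  by apply: eq_bigr => n _; rewrite /even_term addnn -mul2n !mulnA.
have -> : (2 * s.+2 = 1 + (2 * s.+1 + 1))%N by lia.
rewrite expnD expn1 legendre_coef_odd_power //.
rewrite (mul_expansion N (fun l => odd_term s.+1 l j) (fun l n => 'C(l + j, j) *
   ('C(n, j) * binz j (n%:Z - l%:Z)))%N); last first.
  move=> l; rewrite legendre_coef_mul big_distrr /=.
  by apply: eq_bigr => n _; rewrite !mulnA.
apply: eq_bigr => n _; congr (_ * _)%N.
rewrite /even_term (nat_sum_trunc N.+1); last first.
  by move=> k ltNk; rewrite binz_small ?mul0n // (leq_trans (ltn_ord n)).
rewrite big_distrr /=; apply: eq_bigr => l _; rewrite /odd_term subn1 /=.
have -> : (2 * s.+2 - 1 = 2 * s.+1 + 1)%N by lia.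
rewrite expnD expn1.
transitivity ('C(2 * j, j) ^ (2 * s.+1) * ('C(l + j, j) * 'C(l, j)) * 'C(l, j)
   * schmidt_nested j s l * ('C(n, j) * binz j (n%:Z - l%:Z)))%N; first by lia.
by rewrite bin_mul_diag; lia.
Qed.

(** * The sequences of Schmidt *)

(** Summing the expansions of [b_j^r] over [j] gives the defining identity of
    the sequence.  The truncation condition on [a] makes the sum over [j]
    finite with a bound [N + 1] that depends on neither [n] nor [j]. *)
Lemma schmidt_seq_of_expansion (F : numFieldType) r (a : nat -> nat -> nat) :
    (forall n j, (n < j)%N -> a n j = 0%N) ->
    (forall N j,
       (legendre_coef N j ^ r = \sum_(n < N.+1) a n j * legendre_coef N n)%N) ->
  schmidt_seq r (fun n => (\sum_(j \in [set: nat]) a n j)%N%:R : F).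
Proof.
move=> a0 aE N.
under [RHS]eq_bigr => n _ do rewrite -natrM.
rewrite -natr_sum; congr (_%:R).
under [LHS]eq_bigr => j _ do rewrite -expnMn aE.
rewrite exchange_big /=; apply: eq_bigr => n _.
rewrite (nat_sum_trunc N.+1) => [|j ltNj]; last first.
  by rewrite a0 // (leq_trans (ltn_ord n)).
by rewrite -big_distrl mulnC.
Qed.

Lemma schmidt_seq_even (F : numFieldType) s : (0 < s)%N ->
  schmidt_seq (2 * s) (fun n => (schmidt_even s n)%:R : F).
Proof.
move=> s_gt0; apply: (schmidt_seq_of_expansion F (2 * s) (even_term s)) => [n j ltnj|N j].
  by rewrite /even_term (bin_small ltnj) muln0.
exact: legendre_coef_even_power.
Qed.

Lemma schmidt_seq_odd (F : numFieldType) s : (0 < s)%N ->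
  schmidt_seq (2 * s + 1) (fun n => (schmidt_odd s n)%:R : F).
Proof.
move=> s_gt0; apply: (schmidt_seq_of_expansion F (2 * s + 1) (odd_term s)) => [n j ltnj|N j].
  by rewrite /odd_term (bin_small ltnj) muln0.
exact: legendre_coef_odd_power.
Qed.

Theorem theorem1 (F : numFieldType) (c : nat -> nat -> F)
    (c_def : forall r : nat, (2 <= r)%N -> schmidt_seq r (c r)) :
  [/\ forall r k : nat, (2 <= r)%N -> exists z : int, c r k = z%:~R,
      forall n : nat, c 4%N n =
        (\sum_(j \in [set: nat]) 'C(2 * j, j) ^ 3 * 'C(n, j)
           * \sum_(k \in [set: nat])
               binz (k + j) (k%:Z - j%:Z) * binz j (n%:Z - k%:Z)
               * 'C(k, j) * binz (2 * j) (k%:Z - j%:Z))%N%:R,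
      forall n : nat, c 5%N n =
        (\sum_(j \in [set: nat]) 'C(2 * j, j) ^ 4 * 'C(n, j) ^ 2
           * \sum_(k \in [set: nat])
               binz (k + j) (k%:Z - j%:Z) ^ 2 * binz (2 * j) (n%:Z - k%:Z)
               * binz (2 * j) (k%:Z - j%:Z))%N%:R,
      forall s n : nat, (1 <= s)%N ->
        c (2 * s)%N n = (schmidt_even s n)%:R
    & forall s n : nat, (1 <= s)%N ->
        c (2 * s + 1)%N n = (schmidt_odd s n)%:R].
Proof.
have even_formula s n : (1 <= s)%N -> c (2 * s)%N n = (schmidt_even s n)%:R.
  move=> s_gt0; have r_ge2 : (2 <= 2 * s)%N by lia.
  exact: (schmidt_seq_unique (c_def _ r_ge2) (schmidt_seq_even F s s_gt0)).
have odd_formula s n : (1 <= s)%N -> c (2 * s + 1)%N n = (schmidt_odd s n)%:R.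
  move=> s_gt0; have r_ge2 : (2 <= 2 * s + 1)%N by lia.
  exact: (schmidt_seq_unique (c_def _ r_ge2) (schmidt_seq_odd F s s_gt0)).
split=> [r k r_ge2|n|n||] //.
- have -> : r = (2 * r./2 + odd r)%N by lia.
  case: (odd r); first by exists (schmidt_odd r./2 k)%:Z; rewrite odd_formula //; lia.
  by exists (schmidt_even r./2 k)%:Z; rewrite addn0 even_formula //; lia.
- rewrite (even_formula 2 n) //; congr (_%:R); apply: eq_fsbigr => j _.
  by congr (_ * _)%N; apply: eq_fsbigr => k _; rewrite /=; lia.
- rewrite (odd_formula 2 n) //; congr (_%:R); apply: eq_fsbigr => j _.
  by congr (_ * _)%N; apply: eq_fsbigr => k _; rewrite /=; lia.
Qed.
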